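(* Let $(a,b)\in\mathcal H$, $\phi=\phi_{a,b}$, $R=\max(1,|a|^{1/2},|b|)$ and $S_R=\{(x,y)\in K^2:\|(x,y)\|\le R\}$. (a) If $(a,b)\in\mathcal H_{\mathrm{II}}^+$, then $J^+(\phi)$, $J^-(\phi)$, $J(\phi)$ are nonempty, $J^+(\phi)$ is unbounded, and $J^-(\phi)=J(\phi)=\bigcap_{n\ge0}\phi^n(S_R)$; in particular $J^-(\phi)$ is bounded. (b) If $(a,b)\in\mathcal H_{\mathrm{II}}^-$, then $J^+(\phi)$, $J^-(\phi)$, $J(\phi)$ are nonempty, $J^-(\phi)$ is unbounded, and $J^+(\phi)=J(\phi)=\bigcap_{n\ge0}\phi^{-n}(S_R)$; in particular $J^+(\phi)$ is bounded. (c) If $(a,b)\in\mathcal H_{\mathrm{III}}$ and $a$ is a square in $K$, then $J^+(\phi)$, $J^-(\phi)$, $J(\phi)$ are nonempty, and $J^+(\phi)$ and $J^-(\phi)$ are unbounded. (d) If $(a,b)\in\mathcal H_{\mathrm{III}}$ and $a$ is not a square in $K$, then $J^+(\phi)$, $J^-(\phi)$, $J(\phi)$ are empty.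
   Context: $K$ is a field complete and locally compact with respect to a nontrivial non-Archimedean absolute value $|\cdot|$, whose residue field has odd characteristic. $\|(x,y)\|=\max(|x|,|y|)$. $\mathcal H=\{(a,b)\in K^2:b\ne0\}$, $\phi_{a,b}(x,y)=(a+by-x^2,x)$, a bijection with inverse $(x,y)\mapsto(y,\frac1b(-a+x+y^2))$; $\phi^n$ is the $n$-th iterate, $n\in\mathbb Z$. $J^+(\phi)$ (resp. $J^-(\phi)$) is the set of $(x,y)$ with $\|\phi^n(x,y)\|$ bounded as $n\to+\infty$ (resp. $n\to-\infty$); $J(\phi)=J^+(\phi)\cap J^-(\phi)$. Regions: $\mathcal H_{\mathrm{II}}^+=\{|a|\le1,|b|<1\}$, $\mathcal H_{\mathrm{II}}^-=\{|a|\le|b|^2,|b|>1\}$, $\mathcal H_{\mathrm{III}}=\{|a|>\max(1,|b|^2)\}$ (within $\mathcal H$). *)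

(* Defs.v *)
From HB Require Import structures.
From mathcomp Require Import all_boot all_order all_algebra.
From mathcomp Require Import all_classical all_reals all_analysis.

Set Implicit Arguments.
Unset Strict Implicit.
Unset Printing Implicit Defensive.

Import Order.TTheory GRing.Theory Num.Theory.

Local Open Scope classical_set_scope.
Local Open Scope quotient_scope.
Local Open Scope ring_scope.

(* MathComp's normedZmodType cannot play this role: its axiom normrMn,
   `|x *+ n| = `|x| *+ n, fails for a non-Archimedean absolute value. *)
Record nonarch_absv (R : realType) (K : fieldType) := NonArchAbsv {
  absv :> K -> R ;
  absv_ge0 : forall x, 0 <= absv x ;
  absv0P : forall x, absv x = 0 <-> x = 0 ;
  absvM : forall x y, absv (x * y) = absv x * absv y ;
  absvD : forall x y, absv (x + y) <= Num.max (absv x) (absv y)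
}.

Section AbsoluteValue.
Context (R : realType) (K : fieldType) (abs : nonarch_absv R K).
Implicit Types x y : K.

Definition nontrivial_absv : Prop := exists2 x, x != 0 & abs x != 1.

Lemma absv0 : abs 0 = 0.
Proof. exact/absv0P. Qed.

Lemma absv1 : abs 1 = 1.
Proof.
have n0 : abs 1 != 0 by apply/eqP => /absv0P/eqP; rewrite oner_eq0.
by apply: (mulfI n0); rewrite -absvM !mulr1.
Qed.

Lemma absvN x : abs (- x) = abs x.
Proof.
have N1 : abs (-1) = 1.
  have /eqP : abs (-1) ^+ 2 = 1 by rewrite expr2 -absvM mulrNN mulr1 absv1.
  by rewrite sqrp_eq1 ?absv_ge0// => /eqP.
by rewrite -mulN1r absvM N1 mul1r.
Qed.

Lemma absvB x y : abs (x - y) <= Num.max (abs x) (abs y).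
Proof. by rewrite -(absvN y) absvD. Qed.

End AbsoluteValue.

(* K equipped with the metric (x, y) |-> abs (x - y). *)
Definition absv_space (R : realType) (K : fieldType) (abs : nonarch_absv R K)
  : Type := K.

Section Metric.
Context (R : realType) (K : fieldType) (abs : nonarch_absv R K).

Let dist (x y : absv_space abs) : R := abs ((x : K) - (y : K)).

Let distxx x : dist x x = 0.
Proof. by rewrite /dist subrr absv0. Qed.

Let dist_positivity x y : dist x y = 0 -> x = y.
Proof. by move=> /absv0P/eqP; rewrite subr_eq0 => /eqP. Qed.

Let dist_sym x y : dist x y = dist y x.
Proof. by rewrite /dist -absvN opprB. Qed.

Let dist_triangle y x z : dist x z <= dist x y + dist y z.
Proof.
rewrite /dist -(subrK (y : K) (x : K)) -addrA subrK.
by rewrite (le_trans (absvD _ _ _))// ge_max lerDl lerDr !absv_ge0.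
Qed.

HB.instance Definition _ := Choice.copy (absv_space abs) K.
HB.instance Definition _ := isPointed.Build (absv_space abs) (0 : K).
HB.instance Definition _ := isMetric.Build R (absv_space abs)
  distxx dist_positivity dist_sym dist_triangle.

Definition complete_absv : Prop := forall F : set_system (absv_space abs),
  ProperFilter F -> cauchy F -> cvg F.

Definition locally_compact_absv : Prop :=
  locally_compact [set: absv_space abs].

End Metric.

Section ResidueField.
Context (R : realType) (K : fieldType) (abs : nonarch_absv R K).

Definition valuation_ring_pred : {pred K} := fun x => abs x <= 1.

Lemma valuation_ring_subring_closed : subring_closed valuation_ring_pred.
Proof.
split=> [|x y hx hy|x y hx hy]; rewrite unfold_in /=.
- by rewrite absv1.
- by rewrite (le_trans (absvB _ _ _))// ge_max; apply/andP.
- by rewrite absvM mulr_ile1 ?absv_ge0.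
Qed.

HB.instance Definition _ :=
  GRing.isSubringClosed.Build K valuation_ring_pred
    valuation_ring_subring_closed.

Record valuation_ring :=
  ValuationRing { vring_val :> K; _ : vring_val \in valuation_ring_pred }.

HB.instance Definition _ := [isSub for vring_val].
HB.instance Definition _ := [Choice of valuation_ring by <:].
HB.instance Definition _ :=
  [SubChoice_isSubComNzRing of valuation_ring by <:].

Definition maximal_ideal_pred : {pred valuation_ring} :=
  fun x => abs (val x) < 1.

Lemma maximal_ideal_idealr_closed : idealr_closed maximal_ideal_pred.
Proof.
split=> [||x u v hu hv]; rewrite unfold_in /=.
- by rewrite absv0 ltr01.
- by rewrite absv1 ltxx.
- rewrite (le_lt_trans (absvD _ _ _))// gt_max; apply/andP; split=> //.
  rewrite absvM (le_lt_trans _ hu)// ler_piMl ?absv_ge0//.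
  exact: (valP x).
Qed.

HB.instance Definition _ :=
  isIdealr.Build valuation_ring maximal_ideal_pred maximal_ideal_idealr_closed.

Definition residue_field := {ideal_quot maximal_ideal_pred}.

Lemma residue_fieldP (x : residue_field) : x != 0 -> exists y, y * x = 1.
Proof.
elim/quotW: x => x nx.
have {nx} x1 : abs (val x) = 1.
  apply/eqP; rewrite eq_le; apply/andP; split; first exact: (valP x).
  rewrite leNgt; apply: contra nx => hx.
  by rewrite piE /= Quotient.equivE subr0.
have x0 : val x != 0.
  by apply/eqP => /(absv0P abs)/eqP; rewrite x1 oner_eq0.
have hy : (val x)^-1 \in valuation_ring_pred.
  rewrite unfold_in /= -(mul1r (abs _)) -{1}x1.
  by rewrite -absvM mulfV// absv1.
exists (\pi_residue_field (ValuationRing hy)).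
have e : ValuationRing hy * x = 1 by apply: val_inj; rewrite /= mulVf.
by rewrite -rmorphM e rmorph1.
Qed.

(* Characteristic 0 does not count as odd. *)
Definition odd_residue_char : Prop :=
  exists2 p : nat, odd p & p \in [pchar residue_field].

End ResidueField.

Section Henon.
Context (R : realType) (K : fieldType) (abs : nonarch_absv R K).
Implicit Types (a b : K) (v : K * K) (A : set (K * K)).

Definition absv2 v : R := Num.max (abs v.1) (abs v.2).

Definition bounded2 A : Prop := exists M : R, forall v, A v -> absv2 v <= M.

Definition polydisk (r : R) : set (K * K) := [set v | absv2 v <= r].

Definition henon a b v : K * K := (a + b * v.2 - v.1 ^+ 2, v.1).

Definition henon_inv a b v : K * K :=
  (v.2, b^-1 * (- a + v.1 + v.2 ^+ 2)).

Lemma henonK a b : b != 0 -> cancel (henon a b) (henon_inv a b).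
Proof.
move=> b0 [x y]; congr (_, _) => /=.
by rewrite -[a + _ - _]addrA addKr subrK mulKf.
Qed.

Lemma henon_invK a b : b != 0 -> cancel (henon_inv a b) (henon a b).
Proof.
move=> b0 [x y]; congr (_, _) => /=.
by rewrite mulVKf// !addrA addrK addrN add0r.
Qed.

Definition henon_iter a b (n : int) : K * K -> K * K :=
  match n with
  | Posz m => iter m (henon a b)
  | Negz m => iter m.+1 (henon_inv a b)
  end.

Definition Jplus a b : set (K * K) :=
  [set v | bounded2 (range (fun n : nat => henon_iter a b n%:Z v))].

Definition Jminus a b : set (K * K) :=
  [set v | bounded2 (range (fun n : nat => henon_iter a b (- n%:Z) v))].

Definition Jset a b : set (K * K) := Jplus a b `&` Jminus a b.

Definition henon_params : set (K * K) := [set ab | ab.2 != 0].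

Definition region_IIplus : set (K * K) :=
  henon_params `&` [set ab | abs ab.1 <= 1 /\ abs ab.2 < 1].

Definition region_IIminus : set (K * K) :=
  henon_params `&` [set ab | abs ab.1 <= abs ab.2 ^+ 2 /\ 1 < abs ab.2].

Definition region_III : set (K * K) :=
  henon_params `&` [set ab | Num.max 1 (abs ab.2 ^+ 2) < abs ab.1].

Definition henon_radius a b : R :=
  Num.max 1 (Num.max (Num.sqrt (abs a)) (abs b)).

End Henon.

(* Main.v *)
Require Import Defs.
From HB Require Import structures.
From mathcomp Require Import all_boot all_order all_algebra.
From mathcomp Require Import all_classical all_reals all_analysis.
From mathcomp Require Import ring lra.

(* The map (x, y) |-> (-y/b, -x/b) conjugates the inverse of phi_(a,b) to
   phi_(a/b^2, 1/b), exchanges J+ and J-, and scales R by 1/|b|; so only one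
   direction of time has to be studied. A point with |x| > R and |y| <= |x|
   escapes, since |x| is squared at each step. By local compactness |x| cannot
   decrease strictly forever above 1, hence every orbit of J+ ends up in S_R. In
   region II+ the disk S_R is forward invariant, whence J- is contained in S_R,
   and a cluster point of the orbit of 0 lies in J-. In region III an orbit
   inside S_R satisfies |x^2 - a| < |a|, so that a is a square by Hensel; if
   a = c^2, the contraction principle solves x_(n+1) = a + b x_(n-1) - x_n^2 near
   c, which yields a fixed point and a point (x, 0) of J+ whose preimage
   escapes under backward iteration. *)

Set Implicit Arguments.
Unset Strict Implicit.
Unset Printing Implicit Defensive.

Import Order.TTheory GRing.Theory Num.Theory.

Local Open Scope classical_set_scope.
Local Open Scope ring_scope.

(** * Real geometric sequences *)

Lemma expr_small (R : realType) (q e : R) :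
  0 <= q < 1 -> 0 < e -> exists n, q ^+ n < e.
Proof.
move=> /andP[q0 q1] e0.
have /cvg_expr/cvgrPdist_lt/(_ e e0)[n _ /(_ n (leqnn n))] : `|q| < 1.
  by rewrite ger0_norm.
by rewrite /= sub0r normrN ger0_norm ?exprn_ge0//; exists n.
Qed.

Lemma expr_large (R : realType) (q M : R) : 1 < q -> exists n, M < q ^+ n.
Proof.
move=> q1; have q0 : 0 < q by lra.
have M1 : 0 < `|M| + 1 by have := normr_ge0 M; lra.
have [||n] := @expr_small R q^-1 (`|M| + 1)^-1.
- by rewrite invr_ge0 (ltW q0) invf_lt1.
- by rewrite invr_gt0.
rewrite exprVn ltf_pV2 ?posrE ?exprn_gt0// => hn; exists n.
by have := ler_norm M; lra.
Qed.

Lemma le0_geometric (R : realType) (q x C : R) :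
  0 <= q < 1 -> (forall n, x <= C * q ^+ n) -> x <= 0.
Proof.
move=> q01 h; rewrite leNgt; apply/negP => x0.
have C0 : 0 < C by have := h 0%N; rewrite expr0 mulr1; apply: lt_le_trans.
have [n] := expr_small q01 (divr_gt0 x0 C0).
by rewrite ltr_pdivlMr// mulrC ltNge h.
Qed.

(** * Ultrametric estimates *)

Section NonArchimedean.
Context (R : realType) (K : fieldType) (abs : nonarch_absv R K).
Implicit Types (x y : K) (v w : K * K) (r : R).

Lemma absv_gt0 x : x != 0 -> 0 < abs x.
Proof.
by move=> x0; rewrite lt_def absv_ge0 andbT; apply: contraNneq x0 => /absv0P ->.
Qed.

Lemma absv_gt0_neq0 x : 0 < abs x -> x != 0.
Proof. by apply: contraTneq => ->; rewrite absv0 ltxx. Qed.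

Lemma absvV x : abs x^-1 = (abs x)^-1.
Proof.
have [->|x0] := eqVneq x 0; first by rewrite invr0 absv0 invr0.
apply: (mulfI (lt0r_neq0 (absv_gt0 x0))).
by rewrite -absvM !mulfV ?absv1// lt0r_neq0 ?absv_gt0.
Qed.

Lemma absvX x n : abs (x ^+ n) = abs x ^+ n.
Proof. by elim: n => [|n IH]; rewrite ?expr0 ?absv1// !exprS absvM IH. Qed.

Lemma absv_distC x y : abs (x - y) = abs (y - x).
Proof. by rewrite -absvN opprB. Qed.

Lemma absvD_le x y r : abs x <= r -> abs y <= r -> abs (x + y) <= r.
Proof. by move=> hx hy; rewrite (le_trans (absvD _ _ _))// ge_max hx. Qed.

Lemma absvB_le x y r : abs x <= r -> abs y <= r -> abs (x - y) <= r.
Proof. by move=> hx hy; rewrite absvD_le// absvN. Qed.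

Lemma absvD_lt x y r : abs x < r -> abs y < r -> abs (x + y) < r.
Proof. by move=> hx hy; rewrite (le_lt_trans (absvD _ _ _))// gt_max hx. Qed.

Lemma absvB_lt x y r : abs x < r -> abs y < r -> abs (x - y) < r.
Proof. by move=> hx hy; rewrite absvD_lt// absvN. Qed.

(** Isosceles principle: were |x + y| < |x|, the difference x = (x + y) - y of two small elements
    would be too small. It isolates dominant terms in all later estimates. *)
Lemma absvD_eq x y : abs y < abs x -> abs (x + y) = abs x.
Proof.
move=> yx; apply/eqP; rewrite eq_le absvD_le ?(ltW yx)//=.
rewrite leNgt; apply/negP => h.
by have := absvB_lt h yx; rewrite addrK ltxx.
Qed.

Lemma absv_natr_le1 n : abs n%:R <= 1.
Proof.
by elim: n => [|n IH]; rewrite ?absv0// -natr1 absvD_le ?absv1.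
Qed.

Lemma absv2_ge0 v : 0 <= absv2 abs v.
Proof. by rewrite le_max absv_ge0. Qed.

Lemma le_absv2 v r : (absv2 abs v <= r) = (abs v.1 <= r) && (abs v.2 <= r).
Proof. by rewrite ge_max. Qed.

Lemma lt_absv2 v r : (absv2 abs v < r) = (abs v.1 < r) && (abs v.2 < r).
Proof. by rewrite gt_max. Qed.

Lemma absv2_distC v w : absv2 abs (v - w) = absv2 abs (w - v).
Proof. by rewrite /absv2 /= absv_distC [X in Num.max _ X]absv_distC. Qed.

Lemma absv2D_le v w r :
  absv2 abs v <= r -> absv2 abs w <= r -> absv2 abs (v + w) <= r.
Proof.
rewrite !le_absv2 => /andP[? ?] /andP[? ?].
by apply/andP; split; apply: absvD_le.
Qed.

(** For odd p one has 1 = p - 2 (p-1)/2, so |p| < 1 and |2| < 1 together would give |1| < 1. *)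
Lemma absv_two_of_odd_residue_char : odd_residue_char abs -> abs 2%:R = 1.
Proof.
move=> [p podd /andP[pp p0]].
apply/eqP; rewrite eq_le absv_natr_le1 leNgt; apply/negP => h2.
(* The vanishing of p in the residue field puts p in the maximal ideal; the morphisms [f] and [g]
   carry the numeral between the three rings. *)
have hp : abs p%:R < 1.
  move: p0.
  pose f : {rmorphism valuation_ring abs -> residue_field abs} :=
    (\pi_(residue_field abs))%qT.
  rewrite -(rmorph_nat f) -(rmorph0 f) /f piE /= Quotient.equivE subr0.
  rewrite unfold_in /=.
  pose g : {rmorphism valuation_ring abs -> K} := val.
  by rewrite (rmorph_nat g p : vring_val _ = _).
have : abs 1 < 1.
  have -> : 1 = p%:R - 2%:R * (p./2)%:R :> K.
    by rewrite -natrM mul2n -{1}(odd_double_half p) podd natrD addrK.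
  apply: absvB_lt => //; rewrite absvM (le_lt_trans _ h2)//.
  by rewrite ler_piMr ?absv_ge0 ?absv_natr_le1.
by rewrite absv1 ltxx.
Qed.

End NonArchimedean.

(** * Cluster points and limits from local compactness *)

Section LocalCompactness.
Context (R : realType) (K : fieldType) (abs : nonarch_absv R K).
Context (abs_nontrivial : nontrivial_absv abs)
        (abs_loccpt : locally_compact_absv abs).
Implicit Types (x y : K) (v w : K * K) (r : R).

Lemma small_absv r : 0 < r -> exists2 x, x != 0 & abs x < r.
Proof.
have [z z0 z1] : exists2 z, z != 0 & abs z < 1.
  have [z z0] := abs_nontrivial; rewrite neq_lt => /orP[z1|z1]; first by exists z.
  by exists z^-1; rewrite ?invr_eq0// absvV invf_lt1 ?absv_gt0.
move=> r0; have [|n hn] := @expr_small R (abs z) r _ r0.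
  by rewrite absv_ge0.
by exists (z ^+ n); rewrite ?expf_neq0// absvX.
Qed.

(** Multiplication by a small nonzero t moves the sequence into U x U, with U a compact
    neighbourhood of 0; a cluster point found there is divided by t. *)
Lemma bounded_cluster (u : nat -> K * K) (M : R) :
  (forall n, absv2 abs (u n) <= M) ->
  exists p, forall e N, 0 < e -> exists2 n, (N <= n)%N & absv2 abs (u n - p) < e.
Proof.
move=> uM.
have [U] := abs_loccpt (I : [set: absv_space abs] (0 : K)).
move=> U0 [cU _]; move: U0; rewrite withinET => U0.
have [e /= e0 heU] : exists2 e : R, 0 < e & forall x, abs x < e -> U x.
  have /nbhs_ballP[e /= e0 h] := U0; exists e => // x xe; apply: h.
  by rewrite /ball /= sub0r absvN.
have M0 : 0 <= M by exact: le_trans (absv2_ge0 abs (u 0%N)) (uM 0%N).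
(* The denominator M + 1 stays positive when M = 0. *)
have [t t0 te] := @small_absv (e / (M + 1)) (ltac:(rewrite divr_gt0//; lra)).
have at0 := absv_gt0 abs t0.
have tU x : abs x <= M -> U (t * x).
  move=> xM; apply: heU; rewrite absvM.
  move: te; rewrite ltr_pdivlMr; last lra.
  by apply: le_lt_trans; rewrite ler_pM2l//; lra.
pose w n : absv_space abs * absv_space abs := (t * (u n).1, t * (u n).2).
have : (w @ \oo) (U `*` U).
  exists 0%N => // n _; have := uM n; rewrite le_absv2 => /andP[h1 h2].
  by split; exact: tU.
move=> /(compact_setX cU cU) [p [_ clp]].
exists ((p.1 : K) / t, (p.2 : K) / t) => d N d0.
have td0 : 0 < abs t * d by rewrite mulr_gt0.
have [||_ [/= [n Nn <-] [h1 h2]]] := clp [set w n | n in [set n | (N <= n)%N]] (ball p (abs t * d)).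
- by exists N => // n Nn; exists n.
- exact: nbhsx_ballx.
exists n => //; rewrite lt_absv2 /=.
move: h1 h2; rewrite /ball /= => h1 h2.
apply/andP; split.
  rewrite absv_distC -(ltr_pM2l at0) -absvM mulrBr mulrCA mulfV// mulr1.
  exact: h1.
rewrite absv_distC -(ltr_pM2l at0) -absvM mulrBr mulrCA mulfV// mulr1.
exact: h2.
Qed.

Lemma bounded_cluster1 (u : nat -> K) (M : R) :
  (forall n, abs (u n) <= M) ->
  exists p, forall e N, 0 < e -> exists2 n, (N <= n)%N & abs (u n - p) < e.
Proof.
move=> uM.
have [|p hp] := @bounded_cluster (fun n => (u n, u n)) M.
  by move=> n; rewrite le_absv2 /= uM.
exists p.1 => e N /(hp _ N)[n Nn]; rewrite lt_absv2 => /andP[h _].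
by exists n.
Qed.

(* The value group is discrete: two terms of distinct absolute value > 1 are
   at distance > 1, so a decreasing sequence cannot cluster. *)
Lemma no_decreasing_absv (u : nat -> K) :
  ~ (forall n, 1 < abs (u n) /\ abs (u n.+1) < abs (u n)).
Proof.
move=> hu.
have mono m n : (m < n)%N -> abs (u n) < abs (u m).
  elim: n => // n IH; rewrite ltnS leq_eqVlt => /orP[/eqP->|/IH].
    by case: (hu n).
  by apply: lt_trans; case: (hu n).
have [|p hp] := @bounded_cluster1 u (abs (u 0%N)).
  by case=> // n; apply: ltW; apply: mono.
have [m _ hm] := hp 1 0%N ltr01; have [n mn hn] := hp 1 m.+1 ltr01.
have := absvB_lt hm hn; rewrite opprB addrA subrK.
rewrite absvD_eq ?absvN ?mono// ltNge (ltW _)//.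
by case: (hu m).
Qed.

(** By the ultrametric inequality a sum of steps from n on is no larger than the bound on the first,
    so C q^n bounds the whole tail without summing a series. *)
Lemma geometric_limit (u : nat -> K) (C q : R) : 0 < C -> 0 < q < 1 ->
  (forall n, abs (u n.+1 - u n) <= C * q ^+ n) ->
  exists l, forall n, abs (l - u n) <= C * q ^+ n.
Proof.
move=> C0 /andP[q0 q1] hu.
have hmn m n : (n <= m)%N -> abs (u m - u n) <= C * q ^+ n.
  elim: m => [|m IH]; first by rewrite leqn0 => /eqP->; rewrite subrr absv0 mulr_ge0 ?exprn_ge0 ?ltW.
  rewrite leq_eqVlt => /orP[/eqP->|].
    by rewrite subrr absv0 mulr_ge0 ?exprn_ge0 ?ltW.
  rewrite ltnS => nm; rewrite -(subrK (u m) (u m.+1)) -addrA.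
  apply: absvD_le; last exact: IH.
  apply: (le_trans (hu m)); rewrite ler_pM2l//.
  by apply: ler_wiXn2l => //; exact: ltW.
(* Subtracting u_0 makes the sequence bounded by C, whatever the size of u_0. *)
have [|p hp] := @bounded_cluster1 (fun n => u n - u 0%N) C.
  by move=> n; apply: le_trans (hmn n 0%N _) _; rewrite ?expr0 ?mulr1.
exists (p + u 0%N) => n.
have [|m nm hm] := hp (C * q ^+ n) n; first by rewrite mulr_gt0 ?exprn_gt0.
have -> : p + u 0%N - u n = - (u m - u 0%N - p) + (u m - u n) by ring.
by apply: absvD_le; [rewrite absvN ltW|exact: hmn].
Qed.

End LocalCompactness.

(** * Contraction principle, square roots and recurrences *)

Section Contraction.
Context (R : realType) (K : fieldType) (abs : nonarch_absv R K).
Context (abs_nontrivial : nontrivial_absv abs)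
        (abs_loccpt : locally_compact_absv abs).

(** The iterates of T from 0 converge at each index with the uniform rate C q^n, so limits can be
    taken pointwise and no topology on I -> K is needed. *)
Lemma contraction_fixpoint (I : Type) (T : (I -> K) -> I -> K) (C q : R) :
  0 < C -> 0 < q < 1 ->
  (forall f, (forall i, abs (f i) <= C) -> forall i, abs (T f i) <= C) ->
  (forall f g d, (forall i, abs (f i) <= C) -> (forall i, abs (g i) <= C) ->
    (forall i, abs (f i - g i) <= d) ->
    forall i, abs (T f i - T g i) <= q * d) ->
  exists2 f, forall i, abs (f i) <= C & forall i, T f i = f i.
Proof.
move=> C0 q01 TC Tq; have /andP[q0 q1] := q01.
pose u n := iter n T (fun=> 0).
have uC n : forall i, abs (u n i) <= C.
  elim: n => [i|n IH]; last exact: TC.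
  by rewrite /= absv0 ltW.
have uS n : forall i, abs (u n.+1 i - u n i) <= C * q ^+ n.
  elim: n => [|n IH] i; first by rewrite subr0 expr0 mulr1; exact: (uC 1%N).
  by rewrite exprS mulrCA; exact: (Tq (u n.+1) (u n) _ (uC _) (uC _) IH).
have /choice[f hf] i : exists l, forall n, abs (l - u n i) <= C * q ^+ n.
  exact: (geometric_limit abs_nontrivial abs_loccpt (u := fun n => u n i)).
have fC i : abs (f i) <= C by have := hf i 0%N; rewrite subr0 expr0 mulr1.
exists f => // i; apply/eqP; rewrite -subr_eq0; apply/eqP/(absv0P abs)/le_anti.
rewrite absv_ge0 andbT; apply: (@le0_geometric R q _ C); first by rewrite ltW.
(* Both T f and f are within C q^n of u_(n+1), hence of each other, for every n. *)
move=> n; rewrite -(subrK (u n.+1 i) (T f i)) -addrA.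
have qn : C * q ^+ n.+1 <= C * q ^+ n.
  by rewrite ler_pM2l// exprS ler_piMl ?exprn_ge0 ?ltW.
apply: absvD_le.
  by apply: le_trans qn; rewrite exprS mulrCA; exact: (Tq f (u n)).
by rewrite absv_distC; apply: le_trans qn.
Qed.

(* Newton's method with frozen slope 2c: the solution is the fixed point of
   h |-> (G h - h^2) / (2c). *)
Lemma perturbed_sqrt (I : Type) (c : K) (G : (I -> K) -> I -> K) (r : R) :
  abs 2%:R = 1 -> 0 < r < abs c ->
  (forall h, (forall i, abs (h i) <= r) ->
    forall i, abs (G h i) <= abs c * r) ->
  (forall h g d, (forall i, abs (h i) <= r) -> (forall i, abs (g i) <= r) ->
    (forall i, abs (h i - g i) <= d) ->
    forall i, abs (G h i - G g i) <= r * d) ->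
  exists2 h, forall i, abs (h i) <= r &
    forall i, (c + h i) ^+ 2 = c ^+ 2 + G h i.
Proof.
move=> two /andP[r0 rc] Gr Gl; have ac0 : 0 < abs c by exact: lt_trans rc.
have c0 := absv_gt0_neq0 ac0.
have n2 : 2%:R != 0 :> K by apply: (@absv_gt0_neq0 R K abs); rewrite two.
have nz : 2%:R * c != 0 by rewrite mulf_neq0.
have a2c : abs (2%:R * c) = abs c by rewrite absvM two mul1r.
have [|f fr|f g d fr gr fgd i|h hr hT] :=
    @contraction_fixpoint I (fun h i => (G h i - h i ^+ 2) / (2%:R * c))
      r (r / abs c) r0.
- by rewrite divr_gt0//= ltr_pdivrMr// mul1r.
- move=> i; rewrite absvM absvV a2c ler_pdivrMr// mulrC.
  apply: absvB_le; first exact: Gr.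
  by rewrite absvX expr2 ler_pM ?absv_ge0// (le_trans (fr i))// ltW.
- rewrite -mulrBl absvM absvV a2c mulrAC ler_pM2r ?invr_gt0//.
  (* Factoring the difference of squares gives it Lipschitz constant r, the same as G; division by
     2c turns r into r / |c| < 1. *)
  have -> : G f i - f i ^+ 2 - (G g i - g i ^+ 2)
          = (G f i - G g i) - (f i - g i) * (f i + g i) by ring.
  apply: absvB_le; first exact: Gl.
  by rewrite absvM mulrC ler_pM ?absv_ge0// absvD_le.
exists h => // i; have /(congr1 (fun x => x * (2%:R * c))) := hT i.
rewrite mulfVK// => e.
have -> : G h i = h i * (2%:R * c) + h i ^+ 2 by rewrite -e subrK.
ring.
Qed.

(** This is [perturbed_sqrt] on a one-point index set with constant perturbation d. *)
Lemma hensel_square (x d : K) : abs 2%:R = 1 -> abs d < abs x ^+ 2 ->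
  exists c, x ^+ 2 + d = c ^+ 2.
Proof.
move=> two dx.
have ax : 0 < abs x.
  rewrite lt_def absv_ge0 andbT; apply/eqP => x0; move: dx.
  by rewrite x0 expr0n /= ltNge absv_ge0.
have d0 : 0 <= abs d / abs x by rewrite divr_ge0 ?absv_ge0.
have d1 : abs d / abs x < abs x by rewrite ltr_pdivrMr// -expr2.
(* The condition |d| <= |x| r asks for r >= |d| / |x|; the midpoint also gives 0 < r < |x|, even
   when d = 0. *)
pose r := (abs d / abs x + abs x) / 2.
have [|||h _ /(_ tt) e] := @perturbed_sqrt unit x (fun _ _ => d) r two.
- by apply/andP; split; rewrite /r; lra.
- by move=> h _ _; rewrite -ler_pdivrMl// mulrC /r; lra.
- move=> h g e _ _ /(_ tt) he _; rewrite subrr absv0 mulr_ge0//; first by rewrite /r; lra.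
  exact: le_trans (absv_ge0 _ _) he.
- by exists (x + h tt).
Qed.

(* A solution of the three-term recurrence x_(i+1) = c^2 + b x_(i-1) - x_i^2
   near c, indexed by a set I with successor and partial predecessor; a missing
   predecessor counts as 0. *)
Lemma recurrence_solution (I : Type) (prev : I -> option I) (next : I -> I)
    (b c : K) :
  abs 2%:R = 1 -> 1 < abs c -> abs b < abs c ->
  exists2 x : I -> K, forall i, abs (x i) <= abs c &
    forall i, x (next i) = c ^+ 2 + b * oapp x 0 (prev i) - x i ^+ 2.
Proof.
(* Besides being the radius, [r] is a Lipschitz constant for [G]: the successor term contributes 1
   and the predecessor term |b|. *)
move=> two c1 bc; pose r := Num.max 1 (abs b).
have r0 : 0 < r by rewrite lt_max ltr01.
have r1 : 1 <= r by rewrite le_max lexx.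
have br : abs b <= r by rewrite le_max lexx orbT.
have rc : r < abs c by rewrite gt_max c1.
have cr h : abs h <= r -> abs (c + h) <= abs c.
  by move=> hr; rewrite absvD_le// ltW// (le_lt_trans hr).
pose G (h : I -> K) i :=
  b * oapp (fun j => c + h j) 0 (prev i) - (c + h (next i)).
have [||h g d hr gr hgd i|h hr hG] := @perturbed_sqrt I c G r two.
- by rewrite r0.
- move=> h hr i; apply: absvB_le.
    rewrite absvM mulrC ler_pM ?absv_ge0//.
    by case: (prev i) => [j|] /=; rewrite ?absv0 ?absv_ge0 ?cr.
  by rewrite (le_trans (cr _ _))// ler_peMr// absv_ge0.
- have d0 : 0 <= d by exact: le_trans (absv_ge0 _ _) (hgd i).
  have -> : G h i - G g i = b * (oapp (fun j => h j - g j) 0 (prev i))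
       - (h (next i) - g (next i)).
    by rewrite /G; case: (prev i) => [j|] /=; ring.
  apply: absvB_le; last first.
    by rewrite (le_trans (hgd _))// ler_peMl.
  rewrite absvM ler_pM ?absv_ge0//.
  by case: (prev i) => [j|] /=; rewrite ?absv0 ?hgd.
exists (fun i => c + h i) => i; first exact: cr.
by rewrite hG /G; ring.
Qed.

End Contraction.

(** * Orbits of Hénon maps *)

Section Henon.
Context (R : realType) (K : fieldType) (abs : nonarch_absv R K).
Implicit Types (a b : K) (v w : K * K) (A : set (K * K)).

Lemma henon_iterN a b n : henon_iter a b (- n%:Z) = iter n (henon_inv a b).
Proof. by case: n. Qed.

Lemma JplusP a b v : Jplus abs a b v <->
  exists M, forall n, absv2 abs (iter n (henon a b) v) <= M.
Proof.
split=> [[M hM]|[M hM]]; exists M; first by move=> n; apply: hM; exists n.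
by move=> _ [n _ <-]; exact: hM.
Qed.

Lemma JminusP a b v : Jminus abs a b v <->
  exists M, forall n, absv2 abs (iter n (henon_inv a b) v) <= M.
Proof.
split=> [[M hM]|[M hM]]; exists M.
  by move=> n; apply: hM; exists n => //; rewrite henon_iterN.
by move=> _ [n _ <-]; rewrite henon_iterN; exact: hM.
Qed.

Lemma Jminus_iter a b v n :
  Jminus abs a b v -> Jminus abs a b (iter n (henon_inv a b) v).
Proof.
by move=> /JminusP[M hM]; apply/JminusP; exists M => m; rewrite -iterD.
Qed.

Lemma Jplus_iter a b v n :
  Jplus abs a b v -> Jplus abs a b (iter n (henon a b) v).
Proof.
by move=> /JplusP[M hM]; apply/JplusP; exists M => m; rewrite -iterD.
Qed.

Lemma Jplus_of_iter a b v n :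
  Jplus abs a b (iter n (henon a b) v) -> Jplus abs a b v.
Proof.
move=> /JplusP[M hM]; apply/JplusP.
(* The sum of the finitely many initial norms serves as a bound for each of them. *)
exists (Num.max M (\sum_(i < n) absv2 abs (iter i (henon a b) v))) => m.
rewrite le_max; have [nm|mn] := leqP n m.
  by rewrite -{1}(subnK nm) iterD hM.
rewrite orbC (bigD1 (Ordinal mn))//= lerDl sumr_ge0// => i _.
exact: absv2_ge0.
Qed.

Lemma iter_henonK a b n : b != 0 ->
  cancel (iter n (henon a b)) (iter n (henon_inv a b)).
Proof. by move=> b0 v; elim: n => // n IH; rewrite iterSr iterS henonK. Qed.

Lemma iter_henon_invK a b n : b != 0 ->
  cancel (iter n (henon_inv a b)) (iter n (henon a b)).
Proof. by move=> b0 v; elim: n => // n IH; rewrite iterSr iterS henon_invK. Qed.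

(** J+ is invariant under the inverse map, so a bound on J+ bounds backward orbits. Used by
    contraposition: one point of J+ escaping backward makes J+ unbounded. *)
Lemma bounded_Jplus_sub a b : b != 0 ->
  bounded2 abs (Jplus abs a b) -> Jplus abs a b `<=` Jminus abs a b.
Proof.
move=> b0 [M hM] v hv; apply/JminusP; exists M => n; apply: hM.
by apply: (@Jplus_of_iter _ _ _ n); rewrite iter_henon_invK.
Qed.

(** * Escape outside the disk of radius R *)

Section Radius.
Context (a b : K).
Let r := henon_radius abs a b.

Lemma henon_radius_ge1 : 1 <= r.
Proof. by rewrite le_max lexx. Qed.

Lemma absv_le_radius : abs b <= r.
Proof. by rewrite !le_max lexx !orbT. Qed.

Lemma absv_le_sqr_radius : abs a <= r ^+ 2.
Proof.
rewrite -{1}(sqr_sqrtr (absv_ge0 abs a)) lerXn2r ?nnegrE ?sqrtr_ge0//.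
  exact: le_trans ler01 henon_radius_ge1.
by rewrite !le_max lexx !orbT.
Qed.

(** Beyond R the term x^2 strictly dominates both a and b y. *)
Lemma henon_escape_step v : r < abs v.1 -> abs v.2 <= abs v.1 ->
  abs (henon a b v).1 = abs v.1 ^+ 2.
Proof.
move=> rv v21; have r1 := henon_radius_ge1.
rewrite /= addrC absvD_eq ?absvN ?absvX//.
apply: absvD_lt.
  by rewrite (le_lt_trans absv_le_sqr_radius)// ltrXn2r// ?nnegrE; lra.
rewrite absvM expr2 (@le_lt_trans _ _ (abs b * abs v.1))//.
  by rewrite ler_wpM2l ?absv_ge0.
by rewrite ltr_pM2r ?(le_lt_trans absv_le_radius)//; lra.
Qed.

(** Since |x| > 1, squaring preserves the hypotheses and multiplies |x| by at least its initial
    value, which gives geometric growth. *)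
Lemma henon_escape v : r < abs v.1 -> abs v.2 <= abs v.1 -> ~ Jplus abs a b v.
Proof.
move=> rv v21 /JplusP[M hM]; have r1 := henon_radius_ge1.
have v1 : 1 < abs v.1 by lra.
have grow n : [/\ abs v.1 <= abs (iter n (henon a b) v).1,
    abs (iter n (henon a b) v).2 <= abs (iter n (henon a b) v).1 &
    abs v.1 ^+ n <= abs (iter n (henon a b) v).1].
  elim: n => [|n]; first by split=> //=; rewrite expr0 ltW.
  rewrite iterS; set w := iter n _ v => -[h1 h2 h3].
  rewrite henon_escape_step ?(lt_le_trans rv)//=.
  have hw : abs w.1 <= abs w.1 ^+ 2 by rewrite expr2 ler_peMr ?absv_ge0//; lra.
  split=> //; first exact: le_trans hw.
  by rewrite exprS expr2 ler_pM ?absv_ge0 ?exprn_ge0 ?absv_ge0.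
have [n] := expr_large M v1; have [_ _ h] := grow n.
by move=> /lt_le_trans/(_ h); have := hM n; rewrite le_absv2 => /andP[]; lra.
Qed.

End Radius.

(** * Duality between forward and backward time *)

Section Duality.

(* henon_dual conjugates the inverse of phi_(a,b) to phi_(a/b^2,1/b). *)
Definition henon_dual b v : K * K := (- v.2 / b, - v.1 / b).

Lemma henon_dualK b : b != 0 -> cancel (henon_dual b) (henon_dual b^-1).
Proof.
by move=> b0 [x y]; congr (_, _) => /=; rewrite invrK !mulNr opprK mulfVK.
Qed.

Lemma henon_dualVK b : b != 0 -> cancel (henon_dual b^-1) (henon_dual b).
Proof.
by move=> b0 [x y]; congr (_, _) => /=; rewrite invrK !mulNr opprK mulfK.
Qed.

Lemma dual_henon_inv a b v : b != 0 ->
  henon_dual b (henon_inv a b v) = henon (a / b ^+ 2) b^-1 (henon_dual b v).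
Proof. by move=> b0; case: v => x y; congr (_, _) => /=; field. Qed.

Lemma dual_param_a a b : b != 0 -> a / b ^+ 2 / b^-1 ^+ 2 = a.
Proof. by move=> b0; rewrite exprVn invrK mulfVK// expf_neq0. Qed.

Lemma dual_iter_henon_inv a b v n : b != 0 ->
  henon_dual b (iter n (henon_inv a b) v)
  = iter n (henon (a / b ^+ 2) b^-1) (henon_dual b v).
Proof. by move=> b0; elim: n => //= n <-; rewrite dual_henon_inv. Qed.

Lemma dual_iter_henon a b v n : b != 0 ->
  henon_dual b (iter n (henon a b) v)
  = iter n (henon_inv (a / b ^+ 2) b^-1) (henon_dual b v).
Proof.
move=> b0; have b0' : b^-1 != 0 by rewrite invr_eq0.
(* After the inverse conjugation this is [dual_iter_henon_inv] for the dual parameters, whose own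
   dual is (a, b). *)
apply: (can_inj (henon_dualVK b0)).
by rewrite henon_dualK// dual_iter_henon_inv// dual_param_a// invrK henon_dualK.
Qed.

Lemma absv2_dual b v : absv2 abs (henon_dual b v) = absv2 abs v / abs b.
Proof.
by rewrite /absv2 /= !absvM !absvN absvV maxr_pMl ?invr_ge0 ?absv_ge0// maxC.
Qed.

Lemma henon_radius_dual a b : b != 0 ->
  henon_radius abs (a / b ^+ 2) b^-1 = henon_radius abs a b / abs b.
Proof.
move=> b0; have ab0 := absv_gt0 abs b0.
rewrite /henon_radius !maxr_pMl ?invr_ge0 ?(ltW ab0)// absvM !absvV absvX.
rewrite sqrtrM ?absv_ge0// sqrtrV ?exprn_ge0 ?(ltW ab0)//.
rewrite sqrtr_sqr gtr0_norm// mulfV ?(lt0r_neq0 ab0)// mul1r.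
by rewrite maxA maxC [Num.max 1 _]maxC.
Qed.

Lemma Jminus_dual a b : b != 0 ->
  Jminus abs a b = henon_dual b @^-1` Jplus abs (a / b ^+ 2) b^-1.
Proof.
move=> b0; have ab0 := absv_gt0 abs b0.
apply/seteqP; split=> v /=.
  move=> /JminusP[M hM]; apply/JplusP; exists (M / abs b) => n.
  by rewrite -dual_iter_henon_inv// absv2_dual ler_pM2r ?invr_gt0.
move=> /JplusP[M hM]; apply/JminusP; exists (M * abs b) => n.
by rewrite -ler_pdivrMr// -absv2_dual dual_iter_henon_inv.
Qed.

Lemma Jplus_dual a b : b != 0 ->
  Jplus abs a b = henon_dual b @^-1` Jminus abs (a / b ^+ 2) b^-1.
Proof.
move=> b0; rewrite Jminus_dual ?invr_eq0// dual_param_a// invrK.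
by apply/seteqP; split=> v /=; rewrite henon_dualK.
Qed.

Lemma Jset_dual a b : b != 0 ->
  Jset abs a b = henon_dual b @^-1` Jset abs (a / b ^+ 2) b^-1.
Proof. by move=> b0; rewrite /Jset setIC (Jplus_dual a b0) (Jminus_dual a b0). Qed.

Lemma dual_nonempty b A : b != 0 -> A !=set0 -> henon_dual b @^-1` A !=set0.
Proof. by move=> b0 [v Av]; exists (henon_dual b^-1 v); rewrite /= henon_dualVK. Qed.

Lemma dual_bounded2 b A : b != 0 ->
  bounded2 abs (henon_dual b @^-1` A) <-> bounded2 abs A.
Proof.
move=> b0; have ab0 := absv_gt0 abs b0.
split=> [] [M hM].
  exists (M / abs b) => v Av; rewrite -(henon_dualVK b0 v) absv2_dual.
  by rewrite ler_pM2r ?invr_gt0// hM//= henon_dualVK.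
by exists (M * abs b) => v /hM; rewrite absv2_dual ler_pdivrMr.
Qed.

Lemma dual_polydisk b r : b != 0 ->
  polydisk abs r = henon_dual b @^-1` polydisk abs (r / abs b).
Proof.
move=> b0; have ab0 := absv_gt0 abs b0.
by apply/seteqP; split=> v; rewrite /polydisk /= absv2_dual ler_pM2r ?invr_gt0.
Qed.

Lemma bigcap_henonP a b A v : b != 0 ->
  (\bigcap_(n in [set: nat]) (henon_iter a b n%:Z @` A)) v <->
  forall n, A (iter n (henon_inv a b) v).
Proof.
move=> b0; split=> [h n|h n _].
  by have [w Aw <-] := h n I; rewrite /henon_iter iter_henonK.
by exists (iter n (henon_inv a b) v); rewrite ?(iter_henon_invK a)//= iter_henon_invK.
Qed.

Lemma bigcap_henon_invP a b A v : b != 0 ->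
  (\bigcap_(n in [set: nat]) (henon_iter a b (- n%:Z) @` A)) v <->
  forall n, A (iter n (henon a b) v).
Proof.
move=> b0; split=> [h n|h n _].
  by have [w Aw <-] := h n I; rewrite henon_iterN iter_henon_invK.
by exists (iter n (henon a b) v); rewrite // henon_iterN iter_henonK.
Qed.

Lemma bigcap_dual a b A : b != 0 ->
  \bigcap_(n in [set: nat])
      (henon_iter a b (- n%:Z) @` (henon_dual b @^-1` A)) =
  henon_dual b @^-1` (\bigcap_(n in [set: nat])
      (henon_iter (a / b ^+ 2) b^-1 n%:Z @` A)).
Proof.
move=> b0; have b0' : b^-1 != 0 by rewrite invr_eq0.
apply/seteqP; split=> v.
  move=> /(bigcap_henon_invP _ _ _ b0) h.
  apply/(bigcap_henonP _ _ _ b0') => n; rewrite -dual_iter_henon//.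
  exact: h.
move=> /(bigcap_henonP _ _ _ b0') h.
apply/(bigcap_henon_invP _ _ _ b0) => n /=; rewrite dual_iter_henon//.
Qed.

Lemma region_II_dual a b :
  region_IIminus abs (a, b) -> region_IIplus abs (a / b ^+ 2, b^-1).
Proof.
move=> [/= b0 [ab b1]]; have ab0 := absv_gt0 abs b0.
split; [by rewrite /henon_params /= invr_eq0|split => /=].
  by rewrite absvM absvV absvX ler_pdivrMr ?exprn_gt0// mul1r.
by rewrite absvV invf_lt1.
Qed.

Lemma region_III_dual a b :
  region_III abs (a, b) -> region_III abs (a / b ^+ 2, b^-1).
Proof.
move=> [/= b0]; have ab0 := absv_gt0 abs b0; rewrite gt_max => /andP[a1 ab].
split; [by rewrite /henon_params /= invr_eq0|] => /=.
rewrite gt_max absvM !absvV absvX ltr_pdivlMr ?exprn_gt0// mul1r ab/=.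
by rewrite exprVn ltr_pMl// invr_gt0 exprn_gt0.
Qed.

End Duality.

Lemma henon_inv_escape a b v : b != 0 -> henon_radius abs a b < abs v.2 ->
  abs v.1 <= abs v.2 -> ~ Jminus abs a b v.
Proof.
move=> b0 rv v12; have ab0 := absv_gt0 abs b0.
rewrite Jminus_dual//; apply: henon_escape.
  by rewrite henon_radius_dual//= absvM absvN absvV ltr_pM2r ?invr_gt0.
by rewrite /= !absvM !absvN ler_pM2r// absvV invr_gt0.
Qed.

End Henon.

(** * Eventual confinement and region II *)

Section Dynamics.
Context (R : realType) (K : fieldType) (abs : nonarch_absv R K).
Context (abs_nontrivial : nontrivial_absv abs)
        (abs_loccpt : locally_compact_absv abs).
Implicit Types (a b : K) (v w : K * K).

(** A point (x_(m+1), x_m) of J+ does not escape, so |x_(m+1)| > R forces |x_(m+1)| < |x_m|. This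
    cannot last forever, and once |x_m| <= R it stays so. *)
Lemma Jplus_eventually_in_polydisk a b v : Jplus abs a b v ->
  exists n, forall m, (n <= m)%N ->
    absv2 abs (iter m (henon a b) v) <= henon_radius abs a b.
Proof.
move=> hv; set r := henon_radius abs a b.
pose x m := (iter m (henon a b) v).1.
have xS m : r < abs (x m.+1) -> abs (x m.+1) < abs (x m).
  move=> hr; rewrite ltNge; apply/negP => hx.
  exact: (henon_escape hr hx (Jplus_iter _ hv)).
have [n hn] : exists n, abs (x n) <= r.
  apply: contrapT => /forallNP hx.
  have xr n : r < abs (x n) by rewrite ltNge; exact/negP.
  apply: (no_decreasing_absv abs_nontrivial abs_loccpt (u := x)) => n.
  by rewrite xS// (le_lt_trans (henon_radius_ge1 abs a b)) ?xr.
have xn k : abs (x (n + k)%N) <= r.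
  elim: k => [|k IH]; first by rewrite addn0.
  rewrite addnS leNgt; apply/negP => h.
  by have := xS _ h; rewrite ltNge (le_trans IH)// ltW.
(* One more step is needed because the second coordinate lags behind the first. *)
exists n.+1 => -[//|m]; rewrite ltnS => nm.
rewrite le_absv2; apply/andP; split.
  by have := xn (m.+1 - n)%N; rewrite subnKC// ltnW.
by have := xn (m - n)%N; rewrite subnKC.
Qed.

Lemma Jminus_eventually_in_polydisk a b v : b != 0 -> Jminus abs a b v ->
  exists n, forall m, (n <= m)%N ->
    absv2 abs (iter m (henon_inv a b) v) <= henon_radius abs a b.
Proof.
move=> b0; rewrite Jminus_dual// => /Jplus_eventually_in_polydisk[n hn].
exists n => m /hn.
by rewrite henon_radius_dual// -dual_iter_henon_inv// absv2_dual
  ler_pM2r ?invr_gt0 ?absv_gt0.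
Qed.

Lemma henon_inv_continuous a b w e : 0 < e -> exists2 d, 0 < d &
  forall v, absv2 abs (v - w) < d ->
    absv2 abs (henon_inv a b v - henon_inv a b w) < e.
Proof.
(* For b = 0 the convention 0^-1 = 0 makes the second coordinate of [henon_inv] constant. *)
move=> e0; have [->|b0] := eqVneq b 0.
  exists e => // v; rewrite !lt_absv2 /= invr0 !mul0r subrr absv0 e0 andbT.
  by case/andP.
have ab0 := absv_gt0 abs b0; pose N := Num.max 1 (absv2 abs w).
have N1 : 1 <= N by rewrite le_max lexx.
have wN : abs w.2 <= N by rewrite !le_max lexx !orbT.
have Nn : 0 < N by lra.
exists (Num.min (Num.min 1 e) (abs b * e / N)).
  by rewrite !lt_min ltr01 e0 divr_gt0// mulr_gt0.
move=> v; rewrite lt_absv2 /= => /andP[]; rewrite !lt_min.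
move=> /andP[/andP[_ _] hx] /andP[/andP[y1 ye] hy]; rewrite lt_absv2 /= ye /=.
have -> : b^-1 * (- a + v.1 + v.2 ^+ 2) - b^-1 * (- a + w.1 + w.2 ^+ 2)
  = b^-1 * ((v.1 - w.1) + (v.2 - w.2) * ((v.2 - w.2) + (w.2 + w.2))).
  by ring.
rewrite absvM absvV ltr_pdivrMl//; apply: absvD_lt.
  apply: (lt_le_trans hx); rewrite ler_pdivrMr// ler_peMr//.
  by rewrite mulr_ge0 ?ltW.
rewrite absvM; apply: (@le_lt_trans _ _ (abs (v.2 - w.2) * N)).
  rewrite ler_wpM2l ?absv_ge0//; apply: absvD_le; last exact: absvD_le.
  exact: le_trans (ltW y1) N1.
by rewrite -ltr_pdivlMr.
Qed.

Lemma iter_henon_inv_continuous a b n w e : 0 < e -> exists2 d, 0 < d &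
  forall v, absv2 abs (v - w) < d ->
    absv2 abs (iter n (henon_inv a b) v - iter n (henon_inv a b) w) < e.
Proof.
elim: n e => [|n IH] e e0; first by exists e.
have [d d0 hd] := henon_inv_continuous a b (iter n (henon_inv a b) w) e0.
by have [d' d'0 hd'] := IH _ d0; exists d' => // v /hd'/hd.
Qed.

(** The orbit of 0 stays in the unit disk and has a cluster point w. By continuity of the k-th
    backward iterate, it sends w to within 1 of some phi^(n-k)(0), hence into the unit disk. *)
Lemma region_IIplus_nonempty a b :
  region_IIplus abs (a, b) -> Jminus abs a b !=set0.
Proof.
move=> [/= b0 [a1 b1]].
have S1 n : absv2 abs (iter n (henon a b) 0) <= 1.
  elim: n => [|n]; first by rewrite le_absv2 /= absv0 ler01.
  rewrite iterS; move: (iter n _ _) => [x y]; rewrite !le_absv2 /=.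
  move=> /andP[x1 y1]; rewrite x1 andbT.
  apply: absvB_le; last by rewrite absvX exprn_ile1 ?absv_ge0.
  by rewrite absvD_le// absvM mulr_ile1 ?absv_ge0// ltW.
have [w hw] := bounded_cluster abs_nontrivial abs_loccpt S1.
exists w; apply/JminusP; exists 1 => k.
have [d d0 hd] := iter_henon_inv_continuous a b k w ltr01.
have [n kn /hd] := hw d k d0.
rewrite absv2_distC -{1}(subnKC kn) iterD iter_henonK// => /ltW h.
by have := absv2D_le h (S1 (n - k)%N); rewrite subrK.
Qed.

Lemma region_IIplus_dynamics a b : region_IIplus abs (a, b) ->
  let Jp := Jplus abs a b in
  let Jm := Jminus abs a b in
  let J := Jset abs a b in
  [/\ [/\ Jp !=set0, Jm !=set0 & J !=set0],
      ~ bounded2 abs Jp,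
      Jm = J,
      J = \bigcap_(n in [set: nat])
            (henon_iter a b n%:Z @` polydisk abs (henon_radius abs a b)) &
      bounded2 abs Jm].
Proof.
move=> h Jp Jm J; have [/= b0 [a1 b1]] := h.
have ab0 := absv_gt0 abs b0.
have r1 : henon_radius abs a b = 1.
  apply/le_anti; rewrite henon_radius_ge1 andbT !ge_max lexx (ltW b1) andbT /=.
  by rewrite -sqrtr1 ler_wsqrtr.
have Sstep v : absv2 abs v <= 1 -> absv2 abs (henon a b v) <= 1.
  case: v => x y; rewrite !le_absv2 /= => /andP[x1 y1]; rewrite x1 andbT.
  apply: absvB_le; last by rewrite absvX exprn_ile1 ?absv_ge0.
  by rewrite absvD_le// absvM mulr_ile1 ?absv_ge0// ltW.
have Siter n v : absv2 abs v <= 1 -> absv2 abs (iter n (henon a b) v) <= 1.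
  by move=> v1; elim: n => // n /Sstep.
have SJp v : absv2 abs v <= 1 -> Jp v.
  by move=> v1; apply/JplusP; exists 1 => n; exact: Siter.
(* Some backward iterate lies in the unit disk, and forward invariance brings v itself back into
   it. *)
have JmS v : Jm v -> absv2 abs v <= 1.
  move=> /(Jminus_eventually_in_polydisk b0)[n /(_ n (leqnn n))].
  by rewrite r1 => /(Siter n); rewrite iter_henon_invK.
have JmJ : Jm = J.
  by apply/seteqP; split=> v; [move=> hv; split=> //; exact/SJp/JmS|case].
have Jm0 := region_IIplus_nonempty h.
split=> //.
- by split=> //; [exists 0; apply: SJp; rewrite le_absv2 /= absv0 ler01|
    rewrite -JmJ].
(* The witness (0, 1/b) escapes backward as |1/b| > 1 = R, yet its image (a + 1, 0) lies in the unit
   disk, so it belongs to J+. *)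
- move=> /(bounded_Jplus_sub b0)/(_ (0, b^-1)) JpJm.
  apply: (@henon_inv_escape R K abs a b (0, b^-1) b0).
  + by rewrite r1 absvV invf_gt1.
  + by rewrite /= absv0 absv_ge0.
  apply: JpJm; apply: (@Jplus_of_iter _ _ _ _ _ _ 1%N); apply: SJp.
  by rewrite le_absv2 /= mulfV// expr0n subr0 absv0 ler01 andbT absvD_le ?absv1.
- rewrite -JmJ r1; apply/seteqP; split=> v.
    move=> hv; apply/(bigcap_henonP _ _ _ b0) => n.
    exact/JmS/Jminus_iter.
  move=> /(bigcap_henonP _ _ _ b0) hv.
  by apply/JminusP; exists 1 => n; exact: hv.
- by exists 1 => v; exact: JmS.
Qed.

Lemma region_IIminus_dynamics a b : region_IIminus abs (a, b) ->
  let Jp := Jplus abs a b in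
  let Jm := Jminus abs a b in
  let J := Jset abs a b in
  [/\ [/\ Jp !=set0, Jm !=set0 & J !=set0],
      ~ bounded2 abs Jm,
      Jp = J,
      J = \bigcap_(n in [set: nat])
            (henon_iter a b (- n%:Z) @` polydisk abs (henon_radius abs a b)) &
      bounded2 abs Jp].
Proof.
move=> h Jp Jm J; have [/= b0 _] := h.
have [[Jp0 Jm0 J0] Jpu JmJ Jcap Jmb] :=
  region_IIplus_dynamics (region_II_dual h).
rewrite {}/Jp {}/Jm {}/J.
rewrite (Jplus_dual abs a b0) (Jminus_dual abs a b0) (Jset_dual abs a b0).
split.
- by split; apply: dual_nonempty.
- by move=> /(dual_bounded2 abs _ b0).
- by rewrite JmJ.
- by rewrite Jcap (dual_polydisk abs (henon_radius abs a b) b0) bigcap_dual//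
    henon_radius_dual.
- exact/(dual_bounded2 abs _ b0).
Qed.

(** * Region III *)

Section RegionIII.
Context (two : abs 2%:R = 1).

Lemma region_III_sqr_absv b c : region_III abs (c ^+ 2, b) ->
  1 < abs c /\ abs b < abs c.
Proof.
move=> [/= b0]; rewrite gt_max absvX => /andP[].
by rewrite expr_gt1 ?absv_ge0// ltr_pXn2r ?nnegrE ?absv_ge0// => -> ->.
Qed.

(** On a one-point index set, where the point is its own successor and predecessor, the recurrence
    is the equation of a fixed point on the diagonal. *)
Lemma region_III_J_nonempty b c : region_III abs (c ^+ 2, b) ->
  Jset abs (c ^+ 2) b !=set0.
Proof.
move=> h; have [/= b0 _] := h; have [c1 bc] := region_III_sqr_absv h.
have [x _ /(_ tt) xE] := recurrence_solution abs_nontrivial abs_loccpt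
  (fun=> Some tt) (fun=> tt) two c1 bc.
set w := (x tt, x tt).
have fix_w : henon (c ^+ 2) b w = w by congr (_, _).
have fix_inv : henon_inv (c ^+ 2) b w = w by rewrite -{1}fix_w henonK.
exists w; split; [apply/JplusP|apply/JminusP]; exists (absv2 abs w) => n.
  by rewrite iter_fix.
by rewrite iter_fix.
Qed.

(** Indexed by [nat], the recurrence gives a bounded forward orbit from (x_0, 0). Its preimage (0,
    (x_0 - c^2) / b) has norm |c|^2 / |b| > |c| = R and so escapes backward. *)
Lemma region_III_Jplus_unbounded b c : region_III abs (c ^+ 2, b) ->
  ~ bounded2 abs (Jplus abs (c ^+ 2) b).
Proof.
move=> h; have [/= b0 _] := h; have [c1 bc] := region_III_sqr_absv h.
have ab0 := absv_gt0 abs b0.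
have [x xc xE] := recurrence_solution abs_nontrivial abs_loccpt
  (fun n => if n is m.+1 then Some m else None) S two c1 bc.
have orbit n : iter n (henon (c ^+ 2) b) (x 0%N, 0) =
    (x n, if n is m.+1 then x m else 0).
  elim: n => // n IH; rewrite iterS IH /henon /= xE.
  by case: n {IH}.
have Jx : Jplus abs (c ^+ 2) b (x 0%N, 0).
  apply/JplusP; exists (abs c) => n; rewrite orbit le_absv2 /= xc.
  by case: n => [|n]; rewrite ?absv0 ?absv_ge0 ?xc.
move=> /(bounded_Jplus_sub b0)/(_ (henon_inv (c ^+ 2) b (x 0%N, 0))) JJ.
apply: (@henon_inv_escape R K abs (c ^+ 2) b
  (henon_inv (c ^+ 2) b (x 0%N, 0)) b0) => /=.
- rewrite expr0n addr0 addrC absvM absvV.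
  have -> : abs (x 0%N - c ^+ 2) = abs c ^+ 2.
    rewrite addrC absvD_eq absvN absvX// (le_lt_trans (xc _))//.
    by rewrite expr2 ltr_pMl//; lra.
  rewrite ltr_pdivlMl// (@le_lt_trans _ _ (abs b * abs c))//.
    rewrite ler_pM2l// !ge_max (ltW c1) (ltW bc) andbT /=.
    by rewrite absvX sqrtr_sqr ger0_norm ?absv_ge0.
  by rewrite expr2 ltr_pM2r//; lra.
- by rewrite absv0 absv_ge0.
apply: JJ; apply: (@Jplus_of_iter _ _ _ _ _ _ 1%N).
by rewrite /= henon_invK.
Qed.

(** Here R^2 = |a|. If (x, y) and its image (z, x) both lie in S_R, then a - x^2 = z - b y is
    smaller than R^2, so |x|^2 = |a| and [hensel_square] applies. *)
Lemma region_III_Jplus_square a b : region_III abs (a, b) ->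
  Jplus abs a b !=set0 -> exists c, a = c ^+ 2.
Proof.
move=> [/= b0]; rewrite gt_max => /andP[a1 ba] [v].
move=> /Jplus_eventually_in_polydisk[n hn].
set r := henon_radius abs a b in hn.
have ra : r = Num.sqrt (abs a).
  have h1 : 1 <= Num.sqrt (abs a) by rewrite -sqrtr1 ler_wsqrtr// ltW.
  have h2 : abs b <= Num.sqrt (abs a).
    by rewrite -(ger0_norm (absv_ge0 abs b)) -sqrtr_sqr ler_wsqrtr// ltW.
  apply/le_anti; rewrite /r /henon_radius !ge_max h1 h2 lexx /=.
  by rewrite !le_max lexx !orbT.
have r2 : r ^+ 2 = abs a by rewrite ra sqr_sqrtr ?absv_ge0.
have r1 := henon_radius_ge1 abs a b; rewrite -/r in r1.
have r_gt1 : 1 < r by rewrite ra -sqrtr1 ltr_sqrt ?(lt_trans ltr01).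
have br : abs b < r.
  by rewrite -(@ltr_pXn2r _ 2) ?nnegrE ?absv_ge0 ?r2//; lra.
have [] := (hn n (leqnn n), hn n.+1 (leqnSn n)).
rewrite iterS; case: (iter n _ _) => x y; rewrite !le_absv2 /=.
move=> /andP[xr yr] /andP[zr _].
set z := a + b * y - x ^+ 2 in zr.
have dz : abs (z - b * y) < abs a.
  rewrite -r2; apply: absvB_lt.
    by rewrite (le_lt_trans zr)// expr2 ltr_pMl//; lra.
  by rewrite absvM expr2 (@le_lt_trans _ _ (abs b * r)) ?ler_wpM2l ?absv_ge0//
     ltr_pM2r//; lra.
have aE : a = x ^+ 2 + (z - b * y) by rewrite /z; ring.
have x2 : abs x ^+ 2 = abs a.
  have -> : abs x ^+ 2 = abs (x ^+ 2) by rewrite absvX.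
  have -> : x ^+ 2 = a - (z - b * y) by rewrite /z; ring.
  by rewrite absvD_eq ?absvN.
have [|c hc] := hensel_square abs_nontrivial abs_loccpt (x := x)
  (d := z - b * y) two; first by rewrite x2.
by exists c; rewrite -hc.
Qed.

Lemma region_III_square b c : region_III abs (c ^+ 2, b) ->
  let a := c ^+ 2 in
  [/\ [/\ Jplus abs a b !=set0, Jminus abs a b !=set0 & Jset abs a b !=set0],
      ~ bounded2 abs (Jplus abs a b) &
      ~ bounded2 abs (Jminus abs a b)].
Proof.
move=> h a; have [/= b0 _] := h; have [w [wp wm]] := region_III_J_nonempty h.
split; first by split; exists w.
  exact: region_III_Jplus_unbounded.
rewrite Jminus_dual// dual_bounded2//.
(* The dual parameter is again a square, (c / b)^2. *)
have := region_III_dual h; rewrite /a -expr_div_n.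
exact: region_III_Jplus_unbounded.
Qed.

Lemma region_III_nonsquare a b : region_III abs (a, b) ->
  ~ (exists c, a = c ^+ 2) ->
  [/\ Jplus abs a b = set0, Jminus abs a b = set0 & Jset abs a b = set0].
Proof.
move=> h nsq; have [/= b0 _] := h.
have Jp0 : Jplus abs a b = set0.
  by rewrite -subset0 => v hv; apply: nsq; apply: (region_III_Jplus_square h); exists v.
split=> //; last by rewrite /Jset Jp0 set0I.
rewrite -subset0 => v; rewrite Jminus_dual// => hv; apply: nsq.
(* A square root of a / b^2, multiplied by b, is a square root of a. *)
have [|c hc] := region_III_Jplus_square (region_III_dual h).
  by exists (henon_dual b v).
by exists (c * b); rewrite exprMn -hc mulfVK// expf_neq0.
Qed.

End RegionIII.
End Dynamics.

Theorem theorem3p10 (R : realType) (K : fieldType) (abs : nonarch_absv R K)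
    (abs_nontrivial : nontrivial_absv abs)
    (abs_complete : complete_absv abs)
    (abs_locally_compact : locally_compact_absv abs)
    (abs_odd_residue_char : odd_residue_char abs)
    (a b : K) (hab : henon_params (a, b)) :
  let Jp := Jplus abs a b in
  let Jm := Jminus abs a b in
  let J := Jset abs a b in
  let S := polydisk abs (henon_radius abs a b) in
  (region_IIplus abs (a, b) ->
    [/\ [/\ Jp !=set0, Jm !=set0 & J !=set0],
        ~ bounded2 abs Jp,
        Jm = J,
        J = \bigcap_(n in [set: nat]) (henon_iter a b n%:Z @` S) &
        bounded2 abs Jm]) /\
  (region_IIminus abs (a, b) ->
    [/\ [/\ Jp !=set0, Jm !=set0 & J !=set0],
        ~ bounded2 abs Jm,
        Jp = J,
        J = \bigcap_(n in [set: nat]) (henon_iter a b (- n%:Z) @` S) &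
        bounded2 abs Jp]) /\
  (region_III abs (a, b) -> (exists c : K, a = c ^+ 2) ->
    [/\ [/\ Jp !=set0, Jm !=set0 & J !=set0],
        ~ bounded2 abs Jp &
        ~ bounded2 abs Jm]) /\
  (region_III abs (a, b) -> ~ (exists c : K, a = c ^+ 2) ->
    [/\ Jp = set0, Jm = set0 & J = set0]).
Proof.
have two := absv_two_of_odd_residue_char abs_odd_residue_char.
split; first exact: region_IIplus_dynamics.
split; first exact: region_IIminus_dynamics.
split; last exact: region_III_nonsquare.
by move=> h [c hc]; move: h; rewrite hc; exact: region_III_square.
Qed.
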